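(* Let $P$ be a finite poset with height at least $2$ (that is, $P$ contains a chain with at least two distinct elements), and let $CP$ be the cone over $P$. Then $\lambda(CP)\cong\mathbf 3$ and $L(CP)\cong\Diamond\sqcup\mathbf 3$.
   Context: For a poset $P$, $\mathrm{Adj}(P)$ is the set of adjoint pairs (monotone Galois connections) $f=(f^*\dashv f_* )$ of monotone maps $f^*,f_*:P\to P$, i.e. $f^*(p)\le q\iff p\le f_*(q)$ for all $p,q\in P$. For posets $P,Q$ and monotone maps $h,k:P\to Q$, say $k$ is taxotopic to $h$, written $k\preceq h$, if there exist $f\in\mathrm{Adj}(P)$ and $g\in\mathrm{Adj}(Q)$ with $k\circ f^*=g^*\circ h$ and $h\circ f_*=g_*\circ k$. This is a preorder on the set $\mathrm{Pos}(P,Q)$ of monotone maps $P\to Q$. The fundamental poset $\Lambda(P,Q)$ is its posetal reflection (the quotient by the equivalence relation $k\preceq h$ and $h\preceq k$). Put $\lambda(P):=\Lambda(\mathbf 1,P)$, where $\mathbf 1$ is the one-element poset (so for $p,q\in P$: $p\preceq q$ iff there is $f\in\mathrm{Adj}(P)$ with $f^*(q)=p$ and $f_*(p)=q$), and $L(P):=\Lambda(\mathbb Z,P)$, where $\mathbb Z$ is the ordered set of integers. The height of a finite poset is the maximum number of distinct elements in a chain of it. The cone $CP$ is obtained from $P$ by adjoining two new elements $\top,\bot$ with $\bot<p<\top$ for all $p\in P$ (and $\bot<\top$). $\mathbf n$ is the totally ordered set $0<1<\dots<n-1$. $\Diamond$ is the four-element poset $\{\bot,a,b,\top\}$ with $\bot<a,b<\top$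 and $a,b$ incomparable. $\sqcup$ denotes disjoint union of posets. *)

(* Defs.v *)
From HB Require Import structures.
From mathcomp Require Import all_boot all_order all_algebra.
From mathcomp Require Import boolp.

Set Implicit Arguments.
Unset Strict Implicit.
Unset Printing Implicit Defensive.

Import Order.TTheory.
Local Open Scope order_scope.
Local Open Scope quotient_scope.

Definition order_iso {d d' : Order.disp_t}
    (P : porderType d) (Q : porderType d') : Prop :=
  exists2 f : P -> Q, bijective f & {mono f : x y / x <= y}.

Definition chain {d : Order.disp_t} {P : finPOrderType d} (A : {set P}) :
  bool := [forall x in A, forall y in A, x >=< y].

Definition height {d : Order.disp_t} (P : finPOrderType d) : nat :=
  \max_(A : {set P} | chain A) #|A|.

Section PosetalReflection.
Context {d : Order.disp_t} (T : preorderType d).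

Definition mutual_le : rel T := fun x y => (x <= y) && (y <= x).

Lemma mutual_le_refl : reflexive mutual_le.
Proof. by move=> x; rewrite /mutual_le lexx. Qed.

Lemma mutual_le_sym : symmetric mutual_le.
Proof. by move=> x y; rewrite /mutual_le andbC. Qed.

Lemma mutual_le_trans : transitive mutual_le.
Proof.
move=> y x z /andP[xy yx] /andP[yz zy].
by rewrite /mutual_le (le_trans xy yz) (le_trans zy yx).
Qed.

Canonical mutual_le_equiv :=
  EquivRel mutual_le mutual_le_refl mutual_le_sym mutual_le_trans.

Definition posrefl : Type := {eq_quot mutual_le_equiv}.
HB.instance Definition _ := Choice.on posrefl.
HB.instance Definition _ := EqQuotient.on posrefl.

Definition posrefl_le : rel posrefl := fun a b => repr a <= repr b.

Lemma posrefl_le_refl : reflexive posrefl_le.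
Proof. by move=> a; apply: lexx. Qed.

Lemma posrefl_le_anti : antisymmetric posrefl_le.
Proof.
move=> a b ab; rewrite -[a]reprK -[b]reprK.
exact/(@eqquotP _ mutual_le_equiv posrefl).
Qed.

Lemma posrefl_le_trans : transitive posrefl_le.
Proof. by move=> b a c; apply: le_trans. Qed.

HB.instance Definition _ := Order.Le_isPOrder.Build d posrefl
  posrefl_le_refl posrefl_le_anti posrefl_le_trans.

(* The order does not depend on the chosen representatives. *)
Lemma posrefl_piE (x y : T) :
  (\pi_posrefl x <= \pi_posrefl y) = (x <= y).
Proof.
rewrite -[LHS]/(repr (\pi_posrefl x) <= repr (\pi_posrefl y)).
have eqv z : mutual_le (repr (\pi_posrefl z)) z.
  by apply/(@eqquotP _ mutual_le_equiv posrefl); rewrite reprK.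
have /andP[x1 x2] := eqv x; have /andP[y1 y2] := eqv y.
apply/idP/idP => h; first exact: le_trans x2 (le_trans h y1).
exact: le_trans x1 (le_trans h y2).
Qed.

End PosetalReflection.

Record Adj {d : Order.disp_t} (P : porderType d) := MkAdj {
  ladj : {omorphism P -> P};
  radj : {omorphism P -> P};
  adjP : forall p q : P, (ladj p <= q) = (p <= radj q)
}.

(* An alias, so that monotone maps carry the taxotopy preorder and not a
   pointwise one. *)
Definition Pos {d d' : Order.disp_t} (P : porderType d) (Q : porderType d') :
  Type := {omorphism P -> Q}.

Section Taxotopy.
Context {d d' : Order.disp_t} (P : porderType d) (Q : porderType d').

HB.instance Definition _ := gen_eqMixin (Pos P Q).
HB.instance Definition _ := gen_choiceMixin (Pos P Q).

Definition taxotopic (k h : {omorphism P -> Q}) : Prop :=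
  exists (f : Adj P) (g : Adj Q),
    k \o ladj f =1 ladj g \o h /\ h \o radj f =1 radj g \o k.

Definition taxotopicb : rel (Pos P Q) := fun k h => `[< taxotopic k h >].

End Taxotopy.

Section AdjComp.
Context {d : Order.disp_t} {P : porderType d}.

Lemma adj_id_subproof (p q : P) :
  ((idfun : {omorphism P -> P}) p <= q) = (p <= (idfun : {omorphism P -> P}) q).
Proof. by []. Qed.

Definition adj_id : Adj P := MkAdj adj_id_subproof.

Lemma adj_comp_subproof (f g : Adj P) (p q : P) :
  ((ladj f \o ladj g : {omorphism P -> P}) p <= q) =
  (p <= (radj g \o radj f : {omorphism P -> P}) q).
Proof. by rewrite /= !adjP. Qed.

Definition adj_comp (f g : Adj P) : Adj P := MkAdj (adj_comp_subproof f g).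

End AdjComp.

Section TaxotopyPreorder.
Context {d d' : Order.disp_t} (P : porderType d) (Q : porderType d').

Lemma taxotopicb_refl : reflexive (@taxotopicb d d' P Q).
Proof. by move=> h; apply/asboolP; exists adj_id, adj_id. Qed.

Lemma taxotopicb_trans : transitive (@taxotopicb d d' P Q).
Proof.
move=> h k l /asboolP[f [g [kh hk]]] /asboolP[f' [g' [hl lh]]].
apply/asboolP; exists (adj_comp f f'), (adj_comp g g'); split=> x /=.
- by have /= -> := kh (ladj f' x); have /= -> := hl x.
- by have /= -> := lh (radj f x); have /= -> := hk x.
Qed.

HB.instance Definition _ := Order.Le_isPreorder.Build d' (Pos P Q)
  taxotopicb_refl taxotopicb_trans.

End TaxotopyPreorder.

Definition Lambda {d d' : Order.disp_t} (P : porderType d) (Q : porderType d')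
  : porderType d' := posrefl (Pos P Q).

Lemma Lambda_piE {d d' : Order.disp_t} (P : porderType d) (Q : porderType d')
    (k h : Pos P Q) :
  reflect (taxotopic k h)
    (\pi_(posrefl (Pos P Q)) k <= \pi_(posrefl (Pos P Q)) h).
Proof. by rewrite posrefl_piE; apply: asboolP. Qed.

Definition lambda {d : Order.disp_t} (P : porderType d) : porderType d :=
  Lambda 'I_1 P.

Definition L {d : Order.disp_t} (P : porderType d) : porderType d :=
  Lambda int P.

Inductive cone (T : Type) : Type := CBot | CIn of T | CTop.
Arguments CBot {T}.
Arguments CTop {T}.

Definition cone_code {T : Type} (x : cone T) : option (option T) :=
  match x with CBot => None | CIn p => Some (Some p) | CTop => Some None end.

Definition cone_decode {T : Type} (x : option (option T)) : cone T :=
  match x with None => CBot | Some None => CTop | Some (Some p) => CIn p end.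

Lemma cone_codeK {T : Type} : cancel (@cone_code T) cone_decode.
Proof. by case. Qed.

HB.instance Definition _ (T : choiceType) :=
  Choice.copy (cone T) (can_type (@cone_codeK T)).

Section ConeOrder.
Context {d : Order.disp_t} (P : porderType d).

Definition cone_le : rel (cone P) := fun x y =>
  match x, y with
  | CBot, _ | _, CTop => true
  | CIn p, CIn q => p <= q
  | _, _ => false
  end.

Lemma cone_le_refl : reflexive cone_le.
Proof. by case=> //= p. Qed.

Lemma cone_le_anti : antisymmetric cone_le.
Proof. by case=> [|p|] [|q|] //= /le_anti ->. Qed.

Lemma cone_le_trans : transitive cone_le.
Proof. by case=> [|q|] [|p|] [|r|] //=; apply: le_trans. Qed.

HB.instance Definition _ := Order.Le_isPOrder.Build d (cone P)
  cone_le_refl cone_le_anti cone_le_trans.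

End ConeOrder.

Inductive diamond : Type := DBot | Da | Db | DTop.

Definition diamond_code (x : diamond) : bool * bool :=
  match x with
  | DBot => (false, false) | Da => (true, false)
  | Db => (false, true) | DTop => (true, true)
  end.

Definition diamond_decode (x : bool * bool) : diamond :=
  match x with
  | (false, false) => DBot | (true, false) => Da
  | (false, true) => Db | (true, true) => DTop
  end.

Lemma diamond_codeK : cancel diamond_code diamond_decode.
Proof. by case. Qed.

HB.instance Definition _ := Choice.copy diamond (can_type diamond_codeK).

Definition diamond_le : rel diamond := fun x y =>
  match x, y with
  | DBot, _ | _, DTop | Da, Da | Db, Db => true
  | _, _ => false
  end.

Lemma diamond_le_refl : reflexive diamond_le.
Proof. by case. Qed.

Lemma diamond_le_anti : antisymmetric diamond_le.
Proof. by case; case. Qed.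

Lemma diamond_le_trans : transitive diamond_le.
Proof. by case; case; case. Qed.

HB.instance Definition _ := Order.Le_isPOrder.Build (Order.Disp tt tt) diamond
  diamond_le_refl diamond_le_anti diamond_le_trans.

Definition dunion (S T : Type) : Type := (S + T)%type.

HB.instance Definition _ (S T : choiceType) := Choice.on (dunion S T).

Section DisjointUnion.
Context {d d' : Order.disp_t} (P : porderType d) (Q : porderType d').

Definition dunion_le : rel (dunion P Q) := fun x y =>
  match x, y with
  | inl p, inl p' => p <= p'
  | inr q, inr q' => q <= q'
  | _, _ => false
  end.

Lemma dunion_le_refl : reflexive dunion_le.
Proof. by case=> x /=. Qed.

Lemma dunion_le_anti : antisymmetric dunion_le.
Proof. by case=> x [] y //= /le_anti ->. Qed.

Lemma dunion_le_trans : transitive dunion_le.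
Proof. by case=> y [] x [] z //=; apply: le_trans. Qed.

HB.instance Definition _ := Order.Le_isPOrder.Build d (dunion P Q)
  dunion_le_refl dunion_le_anti dunion_le_trans.

End DisjointUnion.

(* Main.v *)
Require Import Defs.
From HB Require Import structures.
From mathcomp Require Import all_boot all_order all_algebra.
From mathcomp Require Import boolp.
From mathcomp Require Import zify.

(** Write [CBot] and [CTop] for the extremal elements of the cone [C] over [P].
    Left adjoints preserve [CBot] and right adjoints preserve [CTop]; apart
    from this, adjoint pairs on a cone are very flexible.  Given [a <= b] and
    [c <= e] in [C], the step function sending [CBot] to [CBot], the rest of
    the down-set of [c] to [a], the rest of the down-set of [e] to [b] and
    everything else to [CTop] has a right adjoint of the same shape
    ([cone_adjP]).  It exchanges the pairs [(c, e)] and [(a, b)] as soon as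
    [c = CBot] implies [a = CBot], [b = CTop] implies [e = CTop], and [a = b]
    is equivalent to [c = e]; this condition is [pair_le a b c e].

    With [a = b] and [c = e] this computes [lambda C]: a point is determined
    up to mutual taxotopy by being [CBot], in [P], or [CTop], and these three
    classes form a chain.

    A monotone map [h] from the integers to [C] is eventually constant on both
    sides because [P] is finite; let [lo h] and [hi h] be its limits.  Adjoint
    endomaps of the integers are unbounded in both directions, so a taxotopy
    from [h] to [k] restricts to the limits and forces
    [pair_le (lo k) (hi k) (lo h) (hi h)].  Conversely this condition is
    sufficient ([taxotopic_intP]): for constant maps the adjunction on [C]
    already does it, and for non-constant ones the adjunction on [C] collapses
    all the intermediate values of [h] and [k], while an adjunction on the
    integers skips the transition zones ([int_adjP]).

    Hence constant and non-constant maps are unrelated.  The constant ones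
    contribute the chain of [lambda C].  The class of a non-constant [h] is
    given by the two truth values of [lo h <> CBot] and [hi h = CTop], with the
    componentwise order.  All four combinations occur; the only one that
    requires two comparable elements of [P] is the one where both limits lie
    in [P]. *)

Set Implicit Arguments.
Unset Strict Implicit.
Unset Printing Implicit Defensive.

Import Order.TTheory GRing.Theory Num.Theory.
Local Open Scope order_scope.
Local Open Scope quotient_scope.

(** * Monotone maps, adjoint pairs and posetal reflections *)

Definition mono_map {d d' : Order.disp_t} {P : porderType d} {Q : porderType d'}
    (f : P -> Q) (fP : {homo f : x y / x <= y}) : {omorphism P -> Q} :=
  HB.pack f (Order.isOrderMorphism.Build d P d' Q f fP).

(** The two halves of a Galois connection are automatically monotone. *)
Section MakeAdjoint.
Context {d : Order.disp_t} {P : porderType d} (l r : P -> P).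
Hypothesis lrP : forall p q, (l p <= q) = (p <= r q).

Lemma galois_homo_l : {homo l : x y / x <= y}.
Proof. by move=> x y xy; rewrite lrP (le_trans xy) // -lrP. Qed.

Lemma galois_homo_r : {homo r : x y / x <= y}.
Proof. by move=> x y xy; rewrite -lrP (le_trans _ xy) // lrP. Qed.

Definition mk_adj : Adj P :=
  @MkAdj d P (mono_map galois_homo_l) (mono_map galois_homo_r) lrP.

End MakeAdjoint.

(** A surjection that preserves and reflects a preorder identifies its posetal
    reflection with the target. *)
Lemma posrefl_iso {d d' : Order.disp_t} (T : preorderType d) (Q : porderType d')
    (phi : T -> Q) :
    {mono phi : x y / x <= y} -> (forall y, exists x, phi x = y) ->
  order_iso (posrefl T) Q.
Proof.
move=> phi_mono phi_surj.
pose psi y := projT1 (cid (phi_surj y)).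
have psiK y : phi (psi y) = y by rewrite /psi; case: cid.
have lepi x y : (phi x <= phi y) = (\pi_(posrefl T) x <= \pi_(posrefl T) y).
  by rewrite phi_mono posrefl_piE.
exists (fun a => phi (repr a)); last by move=> a b; rewrite phi_mono.
exists (fun y => \pi_(posrefl T) (psi y)) => [a|y].
  by rewrite -[RHS]reprK; apply/le_anti; rewrite -!lepi psiK lexx.
by rewrite -[RHS]psiK; apply/le_anti; rewrite !lepi reprK lexx.
Qed.

(** * Adjoint pairs on a cone *)

Section ConeAdjoint.
Context {d : Order.disp_t} {P : porderType d}.
Implicit Types (x y : cone P) (f : Adj (cone P)).

Lemma cbot_le x : CBot <= x. Proof. by case: x. Qed.

Lemma le_ctop x : x <= CTop. Proof. by case: x. Qed.

Lemma le_cbot x : (x <= CBot) = (x == CBot).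
Proof. by rewrite eq_le cbot_le andbT. Qed.

Lemma ctop_le x : (CTop <= x) = (x == CTop).
Proof. by rewrite eq_le le_ctop. Qed.

Lemma ladj_cbot f : ladj f CBot = CBot.
Proof. by apply/eqP; rewrite -le_cbot adjP cbot_le. Qed.

Lemma radj_ctop f : radj f CTop = CTop.
Proof. by apply/eqP; rewrite -ctop_le -adjP le_ctop. Qed.

(** The step functions of an adjunction meant to send [c] to [a] and [e] to
    [b], and back.  The left one fixes [CBot] and sends what is not below [e]
    to [CTop]; the right one is its order dual. *)
Definition cone_l (a b c e : cone P) x : cone P :=
  if x == CBot then CBot else if x <= c then a else if x <= e then b else CTop.

Definition cone_r (a b c e : cone P) y : cone P :=
  if y == CTop then CTop else if b <= y then e else if a <= y then c else CBot.

Lemma cone_adjP a b c e : a <= b -> c <= e ->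
  forall x y, (cone_l a b c e x <= y) = (x <= cone_r a b c e y).
Proof.
move=> ab ce x y; rewrite /cone_l /cone_r.
have [->|xN0] := eqVneq x CBot; first by rewrite !cbot_le.
have [->|yN1] := eqVneq y CTop; first by rewrite !le_ctop.
have topF : (CTop <= y) = false by rewrite ctop_le (negPf yN1).
have botF : (x <= CBot) = false by rewrite le_cbot (negPf xN0).
have ay : b <= y -> a <= y by apply: le_trans.
have xe : x <= c -> x <= e by move=> xc; apply: le_trans xc ce.
case: (boolP (x <= c)) xe => [xc /(_ isT) xe|/negPf xc _].
  by case: (boolP (b <= y)) ay => [_ /(_ isT) ->|_ _] //; case: ifP.
case: (boolP (x <= e)) => [xe|/negPf xe].
  by case: (boolP (b <= y)) => // _; case: ifP.
by rewrite topF; case: ifP => // _; case: ifP.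
Qed.

(** The condition for some adjoint pair to exchange [(c, e)] and [(a, b)]. *)
Definition pair_le (a b c e : cone P) : bool :=
  [&& (c == CBot) ==> (a == CBot), (b == CTop) ==> (e == CTop)
    & (a == b) == (c == e)].

Lemma adj_pair_le f (a b c e : cone P) :
    ladj f c = a -> ladj f e = b -> radj f a = c -> radj f b = e ->
  pair_le a b c e.
Proof.
move=> fc fe fa fb; apply/and3P; split.
- by apply/implyP=> /eqP c0; rewrite -fc c0 ladj_cbot.
- by apply/implyP=> /eqP b1; rewrite -fb b1 radj_ctop.
apply/eqP; apply/eqP/eqP => [ab|ce]; first by rewrite -fa -fb ab.
by rewrite -fc -fe ce.
Qed.

Lemma pair_le_adj a b c e : a <= b -> c <= e -> pair_le a b c e ->
  [/\ cone_l a b c e c = a, cone_l a b c e e = b,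
      cone_r a b c e a = c & cone_r a b c e b = e].
Proof.
move=> ab ce /and3P[/implyP ca /implyP be /eqP abce].
have {}ca : c = CBot -> a = CBot by move/eqP/ca/eqP.
have {}be : b = CTop -> e = CTop by move/eqP/be/eqP.
rewrite /cone_l /cone_r !lexx; split.
- by case: eqP => // /ca.
- case: (eqVneq e CBot) => [e0|_].
    have c0 : c = CBot by apply/eqP; rewrite -le_cbot -e0.
    have : a == b by rewrite abce c0 e0.
    by rewrite (ca c0) => /eqP.
  have -> : (e <= c) = (c == e) by rewrite eq_le ce.
  by rewrite -abce; case: eqP.
- case: (eqVneq a CTop) => [a1|_].
    have b1 : b = CTop by apply/eqP; rewrite -ctop_le -a1.
    have : c == e by rewrite -abce a1 b1.
    by rewrite (be b1) => /eqP.
  have -> : (b <= a) = (a == b) by rewrite eq_le ab.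
  by rewrite abce; case: eqP.
- by case: eqP => // /be.
Qed.

(** The position of an element of the cone: bottom, base or top. *)
Definition level x : 'I_3 :=
  match x with
  | CBot => @Ordinal 3 0 isT | CIn _ => @Ordinal 3 1 isT
  | CTop => @Ordinal 3 2 isT
  end.

Lemma level_surj (p : P) (i : 'I_3) : exists x, level x = i.
Proof.
by case: i => [[|[|[|//]]] i3]; [exists CBot|exists (CIn p)|exists CTop];
  apply: val_inj.
Qed.

Lemma level_le x y : (level x <= level y) = pair_le x x y y.
Proof. by rewrite /pair_le !eqxx andbT; case: x; case: y. Qed.

End ConeAdjoint.

(** * The points of a cone *)

Section Points.
Context {d : Order.disp_t} (P : porderType d).

Lemma taxotopic_pointP (k h : {omorphism 'I_1 -> cone P}) :
  reflect (taxotopic k h) (pair_le (k ord0) (k ord0) (h ord0) (h ord0)).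
Proof.
apply: (iffP idP) => [kh|[f [g [kh hk]]]]; last first.
  have /esym := kh ord0; have /esym := hk ord0; rewrite /= !ord1.
  by move=> gk gh; apply: (adj_pair_le (f := g)).
have [hE _ kE _] := pair_le_adj (lexx _) (lexx _) kh.
exists adj_id, (mk_adj (cone_adjP (lexx (k ord0)) (lexx (h ord0)))).
by split=> x; rewrite /= ord1 ?hE ?kE.
Qed.

Lemma lambda_cone (p : P) : order_iso (lambda (cone P)) 'I_3.
Proof.
apply: (@posrefl_iso _ _ (Pos 'I_1 (cone P)) _ (fun k => level (k ord0))).
  move=> k h; rewrite level_le.
  by apply/taxotopic_pointP/asboolP.
move=> i; have [x xi] := level_surj p i.
by exists (mono_map (fun (_ _ : 'I_1) _ => lexx x)).
Qed.

End Points.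

(** * Limits of monotone maps from the integers *)

Lemma nat_argmin (T : Type) (x0 : T) (u : T -> nat) :
  exists m, forall x, (u m <= u x)%N.
Proof.
have ex : exists n, `[< exists x, u x = n >].
  by exists (u x0); apply/asboolP; exists x0.
case: (ex_minnP ex) => _ /asboolP[m <-] mP.
by exists m => x; apply: mP; apply/asboolP; exists x.
Qed.

Section Limits.
Context {d : Order.disp_t} {P : finPOrderType d}.
Implicit Types (h k : {omorphism int -> cone P}) (x y : int).

(** A strictly monotone and bounded numerical function on the cone. *)
Definition cone_rank (x : cone P) : nat :=
  match x with
  | CBot => 0 | CIn p => #|[set q : P | (q <= p)%O]| | CTop => #|P|.+1
  end.

Lemma cone_rank_lt (x y : cone P) : x < y -> (cone_rank x < cone_rank y)%N.
Proof.
have cP (p : P) : (0 < #|[set q : P | (q <= p)%O]|)%N.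
  by apply/card_gt0P; exists p; rewrite inE.
case: x y => [|p|] [|q|] //=.
- rewrite lt_neqAle => /andP[pq]; rewrite -[_ <= _]/(p <= q) => le_pq.
  have {pq}pq : p < q by rewrite lt_neqAle le_pq andbT; apply: contraNneq pq => ->.
  apply/proper_card/properP; split.
    by apply/subsetP=> r; rewrite !inE => /le_trans; apply.
  by exists q; rewrite inE // lt_geF.
- by move=> _; rewrite ltnS max_card.
Qed.

Lemma cone_rank_max (x : cone P) : (cone_rank x <= #|P|.+1)%N.
Proof. by case: x => //= p; rewrite leqW ?max_card. Qed.

Lemma ex_lo h : exists m : int, forall x : int, x <= m -> h x = h m.
Proof.
have [m mP] := nat_argmin 0%R (fun x => cone_rank (h x)).
exists m => x xm; apply/eqP; apply: contraT => hxm.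
have /cone_rank_lt : h x < h m by rewrite lt_neqAle hxm omorph_le.
by rewrite ltnNge mP.
Qed.

Lemma ex_hi h : exists n : int, forall x : int, n <= x -> h x = h n.
Proof.
have [n nP] := nat_argmin 0%R (fun x => #|P|.+1 - cone_rank (h x))%N.
exists n => x nx; apply/eqP; apply: contraT => hxn.
have /cone_rank_lt : h n < h x by rewrite lt_neqAle eq_sym hxn omorph_le.
by have := nP x; have := cone_rank_max (h x); have := cone_rank_max (h n); lia.
Qed.

(** The limits of a monotone map at minus and plus infinity. *)
Definition lo h : cone P := h (projT1 (cid (ex_lo h))).
Definition hi h : cone P := h (projT1 (cid (ex_hi h))).

Lemma loP h : exists m : int, forall x : int, x <= m -> h x = lo h.
Proof. by rewrite /lo; case: cid => m mP; exists m. Qed.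

Lemma hiP h : exists n : int, forall x : int, n <= x -> h x = hi h.
Proof. by rewrite /hi; case: cid => n nP; exists n. Qed.

Lemma lo_le h x : lo h <= h x.
Proof.
by have [m mP] := loP h; rewrite -(mP (Order.min x m)) ?omorph_le // ge_min lexx ?orbT.
Qed.

Lemma le_hi h x : h x <= hi h.
Proof.
by have [n nP] := hiP h; rewrite -(nP (Order.max x n)) ?omorph_le // le_max lexx ?orbT.
Qed.

Lemma lo_le_hi h : lo h <= hi h.
Proof. exact: le_trans (lo_le h 0%R) (le_hi h 0%R). Qed.

Lemma lo_unique h m c : (forall x, x <= m -> h x = c) -> lo h = c.
Proof.
have [n nP] := loP h => mP.
by rewrite -(nP (Order.min m n)) ?mP // ge_min lexx ?orbT.
Qed.

Lemma hi_unique h n e : (forall x, n <= x -> h x = e) -> hi h = e.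
Proof.
have [m mP] := hiP h => nP.
by rewrite -(mP (Order.max m n)) ?nP // le_max lexx ?orbT.
Qed.

(** The exact point where a non-constant map leaves its lower limit. *)
Lemma lo_threshold h : lo h != hi h ->
  exists m : int, forall x : int, (h x == lo h) = (x <= m).
Proof.
move=> lohi; have [m0 m0P] := loP h; have [n0 n0P] := hiP h.
have ex : exists j : nat, h (m0 + j%:Z)%R != lo h.
  by exists `|n0 - m0|%N; rewrite n0P 1?eq_sym //; lia.
case: (ex_minnP ex) => j jN jP; exists (m0 + j%:Z - 1)%R => x.
apply/idP/idP => [/eqP hx|xm].
  rewrite leNgt; apply: contra jN => jx; rewrite -hx in jP *.
  by rewrite eq_le hx lo_le -hx omorph_le //; lia.
case: (lerP x m0) => [/m0P -> //|m0x].
apply: contraT => hx; have := jP `|x - m0|%N.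
by rewrite (_ : m0 + _ = x)%R; last lia; move=> /(_ hx); lia.
Qed.

(** The exact point where a non-constant map reaches its upper limit. *)
Lemma hi_threshold h : lo h != hi h ->
  exists t : int, forall x : int, (h x == hi h) = (t <= x).
Proof.
move=> lohi; have [m0 m0P] := loP h; have [n0 n0P] := hiP h.
have ex : exists j : nat, h (n0 - j%:Z)%R != hi h.
  by exists `|n0 - m0|%N; rewrite m0P //; lia.
case: (ex_minnP ex) => j jN jP; exists (n0 - j%:Z + 1)%R => x.
apply/idP/idP => [/eqP hx|tx].
  rewrite leNgt; apply: contra jN => xj.
  by rewrite eq_le le_hi -hx omorph_le //; lia.
case: (lerP n0 x) => [/n0P -> //|xn0].
apply: contraT => hx; have := jP `|n0 - x|%N.
by rewrite (_ : n0 - _ = x)%R; last lia; move=> /(_ hx); lia.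
Qed.

(** * Taxotopies between monotone maps from the integers *)

(** The left adjoint matches [x <= m] with [y <= s] and [n <= x] with [t <= y],
    skips the values strictly between [s] and [t], and sends the integers
    strictly between [m] and [n] to [t]. *)
Lemma int_adjP (m n s t : int) : m < n -> s < t ->
  forall x y : int,
    ((if x <= m then x - m + s else Order.max t (x - n + t)) <= y)%R =
    (x <= (if y < t then Order.min m (y - s + m) else y - t + n))%R.
Proof.
move=> mn st x y.
by case: (leP x m) => xm; case: (ltP y t) => yt; rewrite ?ge_max ?le_min; lia.
Qed.

Lemma taxotopic_pair_le k h :
  taxotopic k h -> pair_le (lo k) (hi k) (lo h) (hi h).
Proof.
case=> f [g [kh hk]].
have [mk mkP] := loP k; have [mh mhP] := loP h.
have [nk nkP] := hiP k; have [nh nhP] := hiP h.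
apply: (adj_pair_le (f := g)).
- pose x : int := Order.min mh (radj f mk).
  have xh : x <= mh by rewrite ge_min lexx.
  have xk : ladj f x <= mk by rewrite adjP ge_min lexx orbT.
  by have /= := kh x; rewrite mhP // mkP.
- pose x : int := Order.max nh (radj f (nk - 1) + 1)%R.
  have xh : nh <= x by rewrite le_max lexx.
  have xk : nk <= ladj f x.
    have : ~~ (ladj f x <= nk - 1)%R by rewrite adjP; lia.
    lia.
  by have /= := kh x; rewrite nhP // nkP.
- pose y : int := Order.min mk (ladj f (mh + 1) - 1)%R.
  have yk : y <= mk by rewrite ge_min lexx.
  have yh : radj f y <= mh.
    have : ~~ (mh + 1 <= radj f y)%R by rewrite -adjP -ltNge gt_min ltrBlDr ltrDl ltr01 orbT.
    lia.
  by have /= := hk y; rewrite mhP // mkP.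
- pose y : int := Order.max nk (ladj f nh).
  have yk : nk <= y by rewrite le_max lexx.
  have yh : nh <= radj f y by rewrite -adjP le_max lexx orbT.
  by have /= := hk y; rewrite nhP // nkP.
Qed.

Lemma pair_le_taxotopic k h :
  pair_le (lo k) (hi k) (lo h) (hi h) -> taxotopic k h.
Proof.
move=> kh; have [lE' hE' lE hE] := pair_le_adj (lo_le_hi k) (lo_le_hi h) kh.
pose g := mk_adj (cone_adjP (lo_le_hi k) (lo_le_hi h)).
have /and3P[_ _ /eqP eqkh] := kh.
have [khE|kN] := eqVneq (lo k) (hi k).
  have hhE : lo h = hi h by apply/eqP; rewrite -eqkh khE.
  have kE x : k x = lo k by apply/le_anti; rewrite lo_le khE le_hi.
  have hE0 x : h x = lo h by apply/le_anti; rewrite lo_le hhE le_hi.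
  by exists adj_id, g; split=> x; rewrite /= !(kE, hE0) ?lE ?lE'.
have hN : lo h != hi h by rewrite -eqkh.
have [m mP] := lo_threshold hN; have [t tP] := hi_threshold kN.
have [n nP] := hiP h; have [s sP] := loP k.
have mn : m < n.
  by rewrite ltNge -mP nP // eq_sym.
have st : s < t.
  by rewrite ltNge -tP sP.
exists (mk_adj (int_adjP mn st)), g; split=> x /=.
- have [xm|mx] := boolP (x <= m).
    rewrite sP; last by lia.
    by move: xm; rewrite -mP => /eqP ->.
  have -> : k (Order.max t (x - n + t)%R) = hi k by apply/eqP; rewrite tP; lia.
  rewrite -mP in mx; rewrite /cone_l le_hi.
  (* above its lower limit, [h x] is neither [CBot] nor below [lo h] *)
  have -> : (h x <= lo h) = false by rewrite eq_le lo_le andbT in mx; apply/negbTE.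
  case: eqP => // hx; case/negP: mx.
  by rewrite eq_le lo_le andbT hx cbot_le.
- have [xt|tx] := boolP (x < t).
    have -> : h (Order.min m (x - s + m)%R) = lo h by apply/eqP; rewrite mP; lia.
    have kx : k x != hi k by rewrite tP -ltNge.
    rewrite /cone_r lo_le.
    have -> : (hi k <= k x) = false.
      by apply/negbTE; apply: contra kx => kx; rewrite eq_le le_hi.
    case: eqP => // kx1; case/negP: kx.
    by rewrite eq_le le_hi kx1 le_ctop.
  rewrite nP; last by lia.
  by move: tx; rewrite -leNgt -tP => /eqP ->.
Qed.

Lemma taxotopic_intP k h :
  reflect (taxotopic k h) (pair_le (lo k) (hi k) (lo h) (hi h)).
Proof. exact: (iffP idP) (@pair_le_taxotopic k h) (@taxotopic_pair_le k h). Qed.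

(** * Classification of the monotone maps from the integers *)

(** The class of a map with limits [a <= b]. *)
Definition pair_class (a b : cone P) : dunion diamond 'I_3 :=
  if a == b then inr (level a)
  else inl (diamond_decode (a != CBot, b == CTop)).

Lemma pair_class_le (a b c e : cone P) : a <= b -> c <= e ->
  (pair_class a b <= pair_class c e) = pair_le a b c e.
Proof.
move=> ab ce; rewrite /pair_class.
have [<-|aNb] := eqVneq a b; have [<-|cNe] := eqVneq c e.
- exact: level_le.
- by rewrite /pair_le eqxx (negPf cNe) !andbF.
- by rewrite /pair_le eqxx (negPf aNb) !andbF.
rewrite /pair_le (negPf aNb) (negPf cNe) eqxx andbT.
by case: (a == CBot) (b == CTop) (c == CBot) (e == CTop) => [] [] [] [].
Qed.

(** Step functions realize all pairs of limits. *)
Definition step (a b : cone P) (x : int) : cone P := if x <= 0%R then a else b.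

Lemma step_homo a b : a <= b -> {homo step a b : x y / x <= y}.
Proof.
move=> ab x y xy; rewrite /step.
by case: ifP => x0; case: ifP => y0 //; move: xy x0 y0; lia.
Qed.

Lemma lo_step a b (ab : a <= b) : lo (mono_map (step_homo ab)) = a.
Proof. by apply: (@lo_unique _ 0%R) => x /= x0; rewrite /step x0. Qed.

Lemma hi_step a b (ab : a <= b) : hi (mono_map (step_homo ab)) = b.
Proof. by apply: (@hi_unique _ 1%R) => x /= x0; rewrite /step ifF //; lia. Qed.

Lemma pair_class_surj (p q : P) : p < q ->
  forall y : dunion diamond 'I_3, exists h, pair_class (lo h) (hi h) = y.
Proof.
move=> pq y.
suff [a [b ab <-]] : exists a, exists2 b : cone P, a <= b & pair_class a b = y.
  by exists (mono_map (step_homo ab)); rewrite lo_step hi_step.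
case: y => [[]|i].
- by exists CBot, (CIn p).
- exists (CIn p), (CIn q); first by rewrite -[_ <= _]/(p <= q) ltW.
  by rewrite /pair_class ifF //; apply/negP=> /eqP[pE]; rewrite pE ltxx in pq.
- by exists CBot, CTop.
- by exists (CIn p), CTop.
- have [x <-] := level_surj p i.
  by exists x, x; rewrite ?lexx // /pair_class eqxx.
Qed.

Lemma L_cone (p q : P) : p < q -> order_iso (L (cone P)) (dunion diamond 'I_3).
Proof.
move=> pq.
apply: (@posrefl_iso _ _ (Pos int (cone P)) _ (fun h => pair_class (lo h) (hi h))).
  move=> k h; rewrite pair_class_le ?lo_le_hi //.
  by apply/taxotopic_intP/asboolP.
exact: pair_class_surj pq.
Qed.

Lemma height_ge2 : (2 <= height P)%N -> exists p q : P, p < q.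
Proof.
rewrite leqNgt => /negP hP; apply: contrapT => noPq; apply: hP; rewrite ltnS.
apply/bigmax_leqP => A chA; rewrite leqNgt; apply/negP => /card_gt1P[x [y [xA yA xy]]].
have := forall_inP (forall_inP chA x xA) y yA.
case/orP=> le_xy; apply: noPq; [exists x, y|exists y, x].
  by rewrite lt_neqAle xy.
by rewrite lt_neqAle eq_sym xy.
Qed.

End Limits.

Theorem theorem5p3 (d : Order.disp_t) (P : finPOrderType d)
    (hP : (2 <= height P)%N) :
  order_iso (lambda (cone P)) 'I_3 /\
  order_iso (L (cone P)) (dunion diamond 'I_3).
Proof.
have [p [q pq]] := height_ge2 hP.
by split; [exact: lambda_cone p|exact: L_cone pq].
Qed.
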